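(* Let $T$ be a right $R$-module, $E$ an injective cogenerator of $\mathrm{Mod}\text{-}R$, and $0\to T\to Q_0\xrightarrow{\zeta}Q_1$ an injective copresentation of $T$. The following are equivalent: (1) $T$ is cosilting with respect to $\zeta$; (2) (a) $T$ is partial cosilting with respect to $\zeta$, and (b) there exists an exact sequence $0\to T_1\to T_0\xrightarrow{\gamma}E$ with $T_0,T_1\in\operatorname{Prod}(T)$ such that for every $T'\in\mathcal{B}_\zeta$ the map $\operatorname{Hom}_R(T',\gamma):\operatorname{Hom}_R(T',T_0)\to\operatorname{Hom}_R(T',E)$ is an epimorphism.
   Context: All modules are right modules over a unital associative ring $R$. For $\zeta:Q_0\to Q_1$, $\mathcal{B}_\zeta=\{X \mid \operatorname{Hom}_R(X,\zeta):\operatorname{Hom}_R(X,Q_0)\to\operatorname{Hom}_R(X,Q_1) \text{ is an epimorphism}\}$. $\operatorname{Cogen}(T)$ is the class of modules embeddable in a direct product of copies of $T$; $\operatorname{Prod}(T)$ is the class of modules isomorphic to direct summands of direct products of copies of $T$. An injective copresentation of $T$ is an exact sequence $0\to T\to Q_0\xrightarrow{\zeta}Q_1$ with $Q_0,Q_1$ injective. $T$ is partial cosilting with respect to $\zeta$ if $0\to T\to Q_0\xrightarrow{\zeta}Q_1$ is an injective copresentation, $T\in\mathcal{B}_\zeta$, and $\mathcal{B}_\zeta$ is closed under direct products; $T$ is cosilting with respect to $\zeta$ if $0\to T\to Q_0\xrightarrow{\zeta}Q_1$ is an injective copresentation and $\operatorname{Cogen}(T)=\mathcal{B}_\zeta$.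 *)

(* Defs.v *)
(* Right R-modules are modelled as left modules over the
   converse ring R^c (lmodType R^c); R-linear maps are {linear M -> N}. *)
From HB Require Import structures.
From mathcomp Require Import all_boot all_order all_algebra.
Set Implicit Arguments. Unset Strict Implicit. Unset Printing Implicit Defensive.
Import GRing.Theory.
Local Open Scope ring_scope.

Notation rmodType R := (lmodType (R^c)%type).

Section Cosilting.
Variable R : pzRingType.

Definition exact0 (A B C : rmodType R) (f : {linear A -> B}) (g : {linear B -> C}) :=
  injective f /\ (forall b : B, g b = 0 <-> exists a : A, f a = b).

Definition injective_mod (Q : rmodType R) :=
  forall (A B : rmodType R) (f : {linear A -> B}) (g : {linear A -> Q}),
    injective f -> exists h : {linear B -> Q}, forall a, h (f a) = g a.

Definition cogenerator (E : rmodType R) :=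
  forall (M : rmodType R) (m : M), m != 0 -> exists h : {linear M -> E}, h m != 0.

Definition hom_epi (X A B : rmodType R) (g : {linear A -> B}) :=
  forall f : {linear X -> B}, exists h : {linear X -> A}, forall x, g (h x) = f x.

Definition inB (Q0 Q1 : rmodType R) (zeta : {linear Q0 -> Q1}) (X : rmodType R) :=
  hom_epi X zeta.

Definition is_product (I : Type) (X : I -> rmodType R) (P : rmodType R)
    (p : forall i, {linear P -> X i}) :=
  forall (M : rmodType R) (f : forall i, {linear M -> X i}),
    exists u : {linear M -> P},
      (forall i x, p i (u x) = f i x) /\
      (forall v : {linear M -> P}, (forall i x, p i (v x) = f i x) -> forall x, v x = u x).

Definition closed_under_products (C : rmodType R -> Prop) :=
  forall (I : Type) (X : I -> rmodType R) (P : rmodType R) (p : forall i, {linear P -> X i}),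
    @is_product I X P p -> (forall i, C (X i)) -> C P.

(* X \in Cogen(T): X embeds in a product T^I, i.e. the components
   X -> T of the embedding jointly separate points *)
Definition inCogen (T X : rmodType R) :=
  exists (I : Type) (f : I -> {linear X -> T}), forall x, (forall i, f i x = 0) -> x = 0.

Definition inProd (T X : rmodType R) :=
  exists (I : Type) (P : rmodType R) (p : I -> {linear P -> T}),
    @is_product I (fun _ : I => T) P p /\
    exists (s : {linear X -> P}) (r : {linear P -> X}), forall x, r (s x) = x.

Definition inj_copresentation (T Q0 Q1 : rmodType R)
    (iota : {linear T -> Q0}) (zeta : {linear Q0 -> Q1}) :=
  injective_mod Q0 /\ injective_mod Q1 /\ exact0 iota zeta.

Definition partial_cosilting (T Q0 Q1 : rmodType R)
    (iota : {linear T -> Q0}) (zeta : {linear Q0 -> Q1}) :=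
  inj_copresentation iota zeta /\ inB zeta T /\ closed_under_products (inB zeta).

Definition cosilting (T Q0 Q1 : rmodType R)
    (iota : {linear T -> Q0}) (zeta : {linear Q0 -> Q1}) :=
  inj_copresentation iota zeta /\ (forall X : rmodType R, inCogen T X <-> inB zeta X).

End Cosilting.

(* Main.v *)
(* If Cogen(T) = B_zeta, let M be the pullback of zeta^I : Q0^I -> Q1^I along
   the evaluation E -> Q1^I, where I = Hom(E, Q1). The kernel of the projection
   gamma : M -> E is T^I, and a map T' -> E with T' in B_zeta lifts to M because
   its composites with all maps E -> Q1 lift along zeta. Extending and correcting
   lifts by injectivity of Q0 and Q1 gives M in B_zeta = Cogen(T), so M embeds in
   T^J with J = Hom(M, T). This embedding splits: M is the kernel of a map
   E x Q0^I -> Q1^I between injectives, the inclusion of M extends to T^J, and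
   the extension can be corrected so as to land in M again.
   Conversely B_zeta is closed under submodules since Q1 is injective, so it
   contains Cogen(T); and a nonzero x in X in B_zeta is detected by some X -> E,
   hence by its lift X -> T0 with T0 in Prod(T). *)
Require Import Defs.
From HB Require Import structures.
From mathcomp Require Import all_boot all_order all_algebra.
From mathcomp Require Import boolp functions.
Set Implicit Arguments. Unset Strict Implicit. Unset Printing Implicit Defensive.
Import GRing.Theory.
Local Open Scope ring_scope.

Section RightModules.
Variable R : pzRingType.

(** * Linear maps, submodules and extension into injectives *)

Lemma linear_of (A B : rmodType R) (f : A -> B) :
  linear f -> exists g : {linear A -> B}, g =1 f.
Proof.
move=> lin_f; pose m := GRing.isLinear.Build _ _ _ _ f lin_f.
by exists (HB.pack_for {linear A -> B} f m).
Qed.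

(** Serves to define a map by its graph; single-valuedness makes the chosen function linear. *)
Lemma linear_of_rel (A B : rmodType R) (L : A -> B -> Prop) :
  (forall a, exists b, L a b) ->
  (forall a b b', L a b -> L a b' -> b = b') ->
  (forall (k : R^c) a b a' b',
     L a b -> L a' b' -> L (k *: a + a') (k *: b + b')) ->
  exists g : {linear A -> B}, forall a, L a (g a).
Proof.
move=> /choice[f Lf] L_inj L_lin.
have [k u v|g gE] := @linear_of A B f; first exact: L_inj (L_lin _ _ _ _ _ _ _).
by exists g => a; rewrite gE.
Qed.

Lemma lift_injective (A B X : rmodType R) (i : {linear A -> B})
    (f : {linear X -> B}) :
  injective i -> (forall x, exists a, i a = f x) ->
  exists g : {linear X -> A}, forall x, i (g x) = f x.
Proof.
move=> i_inj fi; apply: (@linear_of_rel X A (fun x a => i a = f x)) => //.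
  by move=> x a b <- /i_inj.
by move=> k x a y b fx fy; rewrite !linearP fx fy.
Qed.

Section Submodule.
Variables (A : rmodType R) (P : A -> Prop).
Hypotheses (P0 : P 0)
  (P_lin : forall (k : R^c) u v, P u -> P v -> P (k *: u + v)).

Definition submod_sig := {x : A | `[< P x >]}.
HB.instance Definition _ := SubChoice.on submod_sig.

Lemma submod_closed_asbool : submod_closed (fun x : A => `[< P x >]).
Proof.
split=> [|k u v /asboolP Pu /asboolP Pv]; first exact/asboolP.
exact/asboolP/P_lin.
Qed.

HB.instance Definition _ := GRing.SubChoice_isSubLmodule.Build R^c A _ submod_sig
  (GRing.submod_closed_semi submod_closed_asbool).

Lemma submodule : exists (M : rmodType R) (i : {linear M -> A}),
  injective i /\ forall a, P a <-> exists m, i m = a.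
Proof.
exists submod_sig, (val : {linear submod_sig -> A}); split=> [|a]; first exact: val_inj.
split=> [Pa|[m <-]]; last exact/asboolP/(valP m).
by exists (Sub a (asboolT Pa)).
Qed.

End Submodule.

(** Since [k] kills the kernel of [g], it induces a map on the image of [g], a submodule of [E];
    injectivity of [Q] extends that map to [E]. *)
Lemma injective_mod_extend (Q M E : rmodType R) (g : {linear M -> E})
    (k : {linear M -> Q}) :
  injective_mod Q -> (forall x, g x = 0 -> k x = 0) ->
  exists f : {linear E -> Q}, forall x, f (g x) = k x.
Proof.
move=> Q_inj gk.
have [||S [i [i_inj iE]]] := @submodule E (fun e => exists x, g x = e).
- by exists 0; rewrite linear0.
- by move=> c _ _ [x <-] [y <-]; exists (c *: x + y); rewrite linearP.
have [s||c s a s' a' [x [sx ->]] [y [sy ->]]|h hE] :=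
    @linear_of_rel S Q (fun s q => exists x, i s = g x /\ q = k x).
- by have [x gx] : exists x, g x = i s; [apply/iE; exists s|exists (k x), x].
- move=> s _ _ [x [sx ->]] [y [sy ->]]; apply/eqP; rewrite -subr_eq0 -linearB.
  by apply/eqP/gk; rewrite linearB -sx -sy subrr.
- by exists (c *: x + y); rewrite !linearP sx sy.
have [f fE] := Q_inj _ _ i h i_inj.
exists f => x; have /iE[s sE] : exists y, g y = g x by exists x.
rewrite -sE fE; have [y [sy ->]] := hE s.
apply/eqP; rewrite -subr_eq0 -linearB; apply/eqP/gk.
by rewrite linearB -sy sE subrr.
Qed.

(** The universal property speaks only of maps, so [x] is replaced by the map from the ring sending
    [r] to [r *: x]; uniqueness identifies it with zero. *)
Lemma product_eq0 (I : Type) (X : I -> rmodType R) (P : rmodType R)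
    (p : forall i, {linear P -> X i}) (x : P) :
  is_product p -> (forall i, p i x = 0) -> x = 0.
Proof.
move=> prodP px0.
have [|f fE] := @linear_of (R^c)^o P (fun r => r *: x).
  by move=> k u v; rewrite scalerDl scalerA.
pose z : {linear (R^c)^o -> P} := \0.
have [u [_ u_uniq]] := prodP (R^c)^o (fun i => p i \o z).
rewrite -[x]scale1r -fE u_uniq => [|i r]; last first.
  by rewrite fE /= linearZZ px0 scaler0 linear0.
by rewrite -(u_uniq z).
Qed.

(** * Function spaces as powers of a module *)

Lemma power_proj (I : Type) (T : rmodType R) (i : I) :
  exists p : {linear (I -> T) -> T}, forall t, p t = t i.
Proof. exact: linear_of. Qed.

Lemma power_tuple (I : Type) (T M : rmodType R) (f : I -> {linear M -> T}) :
  exists g : {linear M -> (I -> T)}, forall x i, g x i = f i x.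
Proof.
have [k u v|g gE] := @linear_of M (I -> T) (fun x i => f i x).
  by apply/funext => i; rewrite linearP.
by exists g => x i; rewrite gE.
Qed.

Lemma power_is_product (I : Type) (T : rmodType R) :
  exists p : I -> {linear (I -> T) -> T},
    is_product p /\ forall i t, p i t = t i.
Proof.
have [p pE] := choice (@power_proj I T).
exists p; split=> // M f; have [g gE] := power_tuple f.
exists g; split=> [i x|v vE x]; first by rewrite pE gE.
by apply/funext => i; rewrite -pE vE -gE.
Qed.

(** * The classes Prod(T), Cogen(T) and B_zeta *)

Lemma inProd_power (I : Type) (T : rmodType R) : inProd T (I -> T).
Proof.
have [p [prod_p _]] := power_is_product I T.
by exists I, (I -> T), p; split; [exact: prod_p|exists idfun, idfun].
Qed.

Lemma inCogenP (T X : rmodType R) :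
  inCogen T X <-> forall x, (forall f : {linear X -> T}, f x = 0) -> x = 0.
Proof.
split=> [[I [f f0]] x x0|X0]; first by apply: f0 => i.
by exists {linear X -> T}, id.
Qed.

Lemma inCogen_products (T : rmodType R) : closed_under_products (inCogen T).
Proof.
move=> I X P p prod_p CX; apply/inCogenP => x x0.
apply: (product_eq0 prod_p) => i; have /inCogenP CXi := CX i; apply: CXi => f.
exact: (x0 (f \o p i)).
Qed.

Lemma inCogen_self (T : rmodType R) : inCogen T T.
Proof. by apply/inCogenP => x /(_ idfun). Qed.

Lemma inCogen_power (I : Type) (T : rmodType R) : inCogen T (I -> T).
Proof.
have [p [prod_p _]] := power_is_product I T.
by apply: inCogen_products prod_p _ => i; apply: inCogen_self.
Qed.

Lemma inProd_inCogen (T X : rmodType R) : inProd T X -> inCogen T X.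
Proof.
move=> [I [P [p [prod_p [s [r rs]]]]]].
apply/inCogenP => x x0; rewrite -[x]rs (_ : s x = 0) ?linear0 //.
by apply: (product_eq0 prod_p) => i; apply: (x0 (p i \o s)).
Qed.

Lemma inB_sub (Q0 Q1 : rmodType R) (zeta : {linear Q0 -> Q1})
    (X Y : rmodType R) (i : {linear Y -> X}) :
  injective_mod Q1 -> injective i -> inB zeta X -> inB zeta Y.
Proof.
move=> Q1_inj i_inj BX f; have [g gE] := Q1_inj _ _ i f i_inj.
by have [h hE] := BX g; exists (h \o i) => y /=; rewrite hE gE.
Qed.

Lemma inCogen_sub_inB (T Q0 Q1 : rmodType R) (zeta : {linear Q0 -> Q1})
    (X : rmodType R) :
  injective_mod Q1 -> closed_under_products (inB zeta) -> inB zeta T ->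
  inCogen T X -> inB zeta X.
Proof.
move=> Q1_inj Bprod BT [I [f f0]].
have [p [prod_p _]] := power_is_product I T.
have [g gE] := power_tuple f.
apply: (@inB_sub _ _ _ _ _ g) => // [x y gxy|]; last exact: Bprod prod_p _.
apply/eqP; rewrite -subr_eq0; apply/eqP/f0 => i.
by rewrite linearB -!gE gxy subrr.
Qed.

Section Cosilting.
Variables (T E Q0 Q1 : rmodType R).
Variables (iota : {linear T -> Q0}) (zeta : {linear Q0 -> Q1}).
Hypotheses (E_inj : injective_mod E) (Q0_inj : injective_mod Q0) (Q1_inj : injective_mod Q1).
Hypotheses (iota_zeta : exact0 iota zeta).

Local Notation I := {linear E -> Q1}.

(* The pullback of [zeta^I : Q0^I -> Q1^I] along the evaluation [E -> Q1^I]. *)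
Lemma pullback_ex : exists (M : rmodType R) (g : {linear M -> E})
    (q : I -> {linear M -> Q0}),
  [/\ forall (k : I) m, k (g m) = zeta (q k m),
      forall m, g m = 0 -> (forall k, q k m = 0) -> m = 0 &
      forall (X : rmodType R) (e : {linear X -> E}) (v : I -> {linear X -> Q0}),
        (forall (k : I) x, k (e x) = zeta (v k x)) ->
        exists u : {linear X -> M},
          forall x, g (u x) = e x /\ forall k, q k (u x) = v k x].
Proof.
have [||M [i [i_inj iE]]] :=
    @submodule (E * (I -> Q0))%type (fun w => forall k : I, k w.1 = zeta (w.2 k)).
- by move=> k; rewrite !linear0.
- by move=> c u v Pu Pv k; rewrite /= !linearP Pu Pv.
have [p pE] := choice (@power_proj I Q0).
exists M, (fst \o i), (fun k => p k \o (snd \o i)); split=> [k m|m|X e v ev].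
- by rewrite /= pE; move: k; apply/iE; exists m.
- move=> /= m1 m2; apply: i_inj; rewrite linear0.
  case: (i m) m1 m2 => e q /= -> q0; congr (_, _).
  by apply/funext => k; rewrite -pE q0.
have [c x y|w wE] := @linear_of X (E * (I -> Q0))%type (fun x => (e x, v^~ x)).
  by congr (_, _); [|apply/funext => k]; rewrite /= linearP.
have [x|u uE] := @lift_injective _ _ _ i w i_inj.
  by apply/iE => k; rewrite wE /= ev.
by exists u => x; split=> [|k]; rewrite /= ?pE uE wE.
Qed.

Hypothesis CogenE : forall X : rmodType R, inCogen T X <-> inB zeta X.

Lemma zeta_iota t : zeta (iota t) = 0.
Proof. by have [_ z0] := iota_zeta; apply/z0; exists t. Qed.

Lemma factor_iota (X : rmodType R) (h : {linear X -> Q0}) :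
  (forall x, zeta (h x) = 0) -> exists j : {linear X -> T}, forall x, iota (j x) = h x.
Proof.
have [iota_inj z0] := iota_zeta => zh0.
by apply: lift_injective => // x; apply/z0.
Qed.

Lemma cosilting_approximation :
  exists (T0 T1 : rmodType R) (a : {linear T1 -> T0}) (gamma : {linear T0 -> E}),
    [/\ inProd T T0, inProd T T1, exact0 a gamma &
        forall T' : rmodType R, inB zeta T' -> hom_epi T' gamma].
Proof.
have [M [g [q [gq M0 M_univ]]]] := pullback_ex.
have M_eq (m m' : M) : g m = g m' -> (forall k, q k m = q k m') -> m = m'.
  move=> gm qm; apply/eqP; rewrite -subr_eq0; apply/eqP/M0 => [|k].
    by rewrite linearB gm subrr.
  by rewrite linearB qm subrr.
have [p [_ pE]] := power_is_product I T.
(* The inclusion of [T^I] into [M] has zero component in [E] and [iota] of the coordinates in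
   [Q0^I]. *)
have [k t|a aE] := M_univ (I -> T) \0 (fun k => iota \o p k).
  by rewrite /= linear0 zeta_iota.
have [iota_inj iota_ker] := iota_zeta.
have a_exact : exact0 a g.
  split=> [s t ast|m].
    apply/funext => k; apply: iota_inj; rewrite -!pE.
    have [_ /(_ k) /= <-] := aE s; have [_ /(_ k) /= <-] := aE t.
    by rewrite ast.
  split=> [gm0|[t <-]]; last by have [-> _] := aE t.
  have zq k : exists t, iota t = q k m by apply/iota_ker; rewrite -gq gm0 linear0.
  have [t tE] := choice zq; exists t.
  have [ga qa] := aE t; apply: M_eq => [|k]; first by rewrite ga gm0.
  by rewrite qa /= pE.
have BM : inB zeta M.
  (* On [ker g], a power of [T], the map [f] lifts to [Q0]; subtracting an
     extension of that lift to [M], what remains factors through [g] and so is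
     one of the maps [k] indexing the pullback. *)
  move=> f.
  have /CogenE BTI := inCogen_power I T.
  have [h0 h0E] := BTI (f \o a).
  have [a_inj a_ker] := a_exact.
  have [h hE] := Q0_inj h0 a_inj.
  have [m|k kE] := injective_mod_extend (g := g) (k := f \- (zeta \o h)) Q1_inj.
    by move=> /a_ker[t <-]; rewrite /= hE h0E subrr.
  by exists (h \+ q k) => m /=; rewrite linearD -gq kE /= addrC subrK.
exists M, (I -> T), a, g; split=> //; last 1 first.
(* Lifts of all [k \o e] along [zeta] are compatible with [e], so the pullback assembles them into a
   lift of [e]. *)
- move=> X BX e; have [v vE] := choice (fun k : I => BX (k \o e)).
  have [k x|u uE] := M_univ X e v; first by rewrite vE.
  by exists u => x; have [] := uE x.
- pose J := {linear M -> T}.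
  have [s sE] := power_tuple (id : J -> {linear M -> T}).
  have [pJ [_ pJE]] := power_is_product J T.
  have s_inj : injective s.
    move=> x y sxy; apply/eqP; rewrite -subr_eq0; apply/eqP.
    have /CogenE/inCogenP CM := BM; apply: CM => f.
    by rewrite linearB -!sE sxy subrr.
  have [e eE] := E_inj g s_inj.
  (* A correction term through [T^J], the power indexed by all maps from [M] to
     [T], makes the extension of [q k] compatible with the pullback. *)
  have v_ex (k : I) : exists v : {linear (J -> T) -> Q0},
      (forall m, v (s m) = q k m) /\ forall x, k (e x) = zeta (v x).
    have [y yE] := Q0_inj (q k) s_inj.
    have /CogenE BTJ := inCogen_power J T.
    have [h hE] := BTJ ((zeta \o y) \- (k \o e)).
    (* On the image of [s] the lift [h] lands in the kernel of [zeta], so [h \o s] is [iota \o j].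
       As [j] is itself an index in [J], the coordinate [pJ j] extends [j] to the power. *)
    have [m|j jE] := @factor_iota M (h \o s).
      by rewrite /= hE /= yE eE gq subrr.
    exists (y \- h \+ (iota \o pJ j)); split=> [m|x] /=.
      by rewrite pJE sE jE /= subrK yE.
    by rewrite linearD linearB zeta_iota addr0 hE /= subKr.
  have [v vE] := choice v_ex.
  (* The extensions [e] of [g] and [v k] of [q k] are compatible, hence define a retraction [r] of
     [s]. *)
  have [k x|r rE] := M_univ (J -> T) e v; first by have [_ ->] := vE k.
  have [pP [prod_pP _]] := power_is_product J T.
  exists J, (J -> T), pP; split; first exact: prod_pP.
  exists s, r => m; have [gr qr] := rE (s m).
  by apply: M_eq => [|k]; [rewrite gr eE|rewrite qr; have [-> _] := vE k].
- exact: inProd_power.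
Qed.

End Cosilting.

End RightModules.

Theorem theorem3p7 (R : pzRingType) (T E Q0 Q1 : rmodType R)
    (iota : {linear T -> Q0}) (zeta : {linear Q0 -> Q1}) :
  injective_mod E -> cogenerator E -> inj_copresentation iota zeta ->
  (cosilting iota zeta <->
   (partial_cosilting iota zeta /\
    exists (T0 T1 : rmodType R) (a : {linear T1 -> T0}) (gamma : {linear T0 -> E}),
      [/\ inProd T T0, inProd T T1, exact0 a gamma &
          forall T' : rmodType R, inB zeta T' -> hom_epi T' gamma])).
Proof.
move=> E_inj E_cogen copr; have [Q0_inj [Q1_inj iota_zeta]] := copr.
split=> [[_ CogenE]|[[_ [BT Bprod]] [T0 [T1 [a [gamma [PT0 _ _ gamma_epi]]]]]]].
  split; last exact: (cosilting_approximation E_inj Q0_inj Q1_inj iota_zeta CogenE).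
  split=> //; split=> [|I X P p prod_p BX]; first exact/CogenE/inCogen_self.
  by apply/CogenE/(inCogen_products prod_p) => i; apply/CogenE.
split=> // X; split=> [|BX]; first exact: inCogen_sub_inB Q1_inj Bprod BT.
apply/inCogenP => x x0; apply/eqP/negPn/negP => /E_cogen[h /negP[]].
(* [T0] is cogenerated by [T], so [f x] vanishes once all maps from [X] to [T] kill [x]. *)
have [f fE] := gamma_epi X BX h; have /inProd_inCogen/inCogenP CT0 := PT0.
by rewrite -fE (CT0 (f x)) ?linear0 // => u; apply: (x0 (u \o f)).
Qed.
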